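(* The following three sets of morphisms of $\epsilon$-simplicial sets generate the same weakly saturated class: \begin{align*} J_1&=\epsilon\text{-}\mathrm{Horn}\cup\{\,\Delta_\epsilon^{\{0,1,2,4\}}\cup\Delta^{\{0,2,3\}}\subset\Delta_\epsilon^4\,\},\\ J_2&=\epsilon\text{-}\mathrm{Horn}\cup\{\,\Delta_\epsilon^{\{0,2,3,4\}}\cup\Delta^{\{1,2,4\}}\subset\Delta_\epsilon^4\,\},\\ J_3&=\epsilon\text{-}\mathrm{Horn}\cup\{\,\Delta_\epsilon^{\{0,1,2,4\}}\cup\Delta_\epsilon^{\{0,2,3,4\}}\subset\Delta_\epsilon^4\,\}. \end{align*} That is, $\overline{J_1}=\overline{J_2}=\overline{J_3}$.
   Context: $\Delta$ is the category of finite chains $[n]=\{0<\dots<n\}$ and non-decreasing maps. $\Delta_\epsilon$ is the category obtained from $\Delta$ by freely adding one object $[\epsilon]$, one arrow $w\colon[1]\to[\epsilon]$, and the induced compositions. An $\epsilon$-simplicial set is a presheaf of sets on $\Delta_\epsilon$; equivalently, a simplicial set $X$ together with a set $X_\epsilon$ and a map $X_\epsilon\to X_1$ (edges in its image are ''marked''). A simplicial set is regarded as an $\epsilon$-simplicial set with $X_\epsilon=\emptyset$. For $n\ge1$, $\Delta_\epsilon^n$ is the $\epsilon$-simplicial set with underlying simplicial set the standard simplex $\Delta^n$ and $(\Delta_\epsilon^n)_\epsilon$ a one-element set mapped to the edge from $0$ to $n$. For $S\subseteq\{0,\dots,n\}$, $\Delta^S\subseteq\Delta^n$ is the face spanned by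 the vertices in $S$ (with no marked edge); if $0,n\in S$, $\Delta_\epsilon^S\subseteq\Delta_\epsilon^n$ is the same face with the edge from $0$ to $n$ marked. $\partial_i\Delta_\epsilon^n\subset\Delta_\epsilon^n$ is the codimension-one face opposite the vertex $i$, where the marked edge remains marked if it belongs to the face. $\Lambda^n_{\epsilon,i}=\bigcup_{j\neq i}\partial_j\Delta_\epsilon^n$. $\epsilon\text{-}\mathrm{Horn}$ denotes the set of inclusions $\Lambda^n_{\epsilon,0}\subset\Delta_\epsilon^n$ and $\Lambda^n_{\epsilon,n}\subset\Delta_\epsilon^n$, $n\ge1$. A class of morphisms in a cocomplete category is weakly saturated if it is closed under compositions, transfinite compositions, pushouts and retracts. For a set $\mathcal{I}$ of morphisms of $\epsilon$-simplicial sets, $\overline{\mathcal{I}}$ is the class of morphisms having the left lifting property with respect to all morphisms that have the right lifting property with respect to every element of $\mathcal{I}$; it is the least weakly saturated class containing $\mathcal{I}$, called the weakly saturated class generated by $\mathcal{I}$. *)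

(* Defs.v *)
From HB Require Import structures.
From mathcomp Require Import all_boot.

Set Implicit Arguments.
Unset Strict Implicit.
Unset Printing Implicit Defensive.

(* The chain [n] = {0 < ... < n} is 'I_n.+1. *)
Record chain_map (m n : nat) := ChainMap {
  chain_fun :> {ffun 'I_m.+1 -> 'I_n.+1};
  chain_monoP :
    [forall i : 'I_m.+1, forall j : 'I_m.+1, (i <= j) ==> (chain_fun i <= chain_fun j)]
}.

HB.instance Definition _ m n := [isSub for @chain_fun m n].
HB.instance Definition _ m n := [Finite of chain_map m n by <:].

Lemma chain_mono m n (f : chain_map m n) (i j : 'I_m.+1) :
  i <= j -> f i <= f j.
Proof. by move: (chain_monoP f) => /forallP/(_ i)/forallP/(_ j)/implyP. Qed.

Lemma chain_ext m n (f g : chain_map m n) : f =1 g -> f = g.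
Proof. by move=> fg; apply/val_inj/ffunP. Qed.

Lemma mk_chain_subproof m n (f : 'I_m.+1 -> 'I_n.+1) :
  {homo f : i j / i <= j} ->
  [forall i : 'I_m.+1, forall j : 'I_m.+1, (i <= j) ==> (finfun f i <= finfun f j)].
Proof.
by move=> fP; apply/forallP => i; apply/forallP => j; apply/implyP; rewrite !ffunE => /fP.
Qed.

Definition mk_chain m n (f : 'I_m.+1 -> 'I_n.+1)
    (fP : {homo f : i j / i <= j}) : chain_map m n :=
  ChainMap (mk_chain_subproof fP).

Lemma mk_chainE m n f fP : @mk_chain m n f fP =1 f.
Proof. by move=> i; rewrite ffunE. Qed.

Definition chain_id n : chain_map n n := @mk_chain n n id (fun _ _ => id).

Definition chain_comp m n p (g : chain_map n p) (f : chain_map m n) :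
    chain_map m p :=
  @mk_chain m p (g \o f) (fun i j ij => chain_mono g (chain_mono f ij)).

Arguments chain_id : simpl never.
Arguments chain_comp : simpl never.

Lemma chain_idE n : chain_id n =1 id.
Proof. exact: mk_chainE. Qed.

Lemma chain_compE m n p (g : chain_map n p) (f : chain_map m n) i :
  chain_comp g f i = g (f i).
Proof. exact: mk_chainE. Qed.

Lemma chain_comp1 m n (f : chain_map m n) : chain_comp f (chain_id m) = f.
Proof. by apply: chain_ext => i; rewrite chain_compE chain_idE. Qed.

Lemma chain_1comp m n (f : chain_map m n) : chain_comp (chain_id n) f = f.
Proof. by apply: chain_ext => i; rewrite chain_compE chain_idE. Qed.

Lemma chain_compA m n p q (h : chain_map p q) (g : chain_map n p)
    (f : chain_map m n) :
  chain_comp h (chain_comp g f) = chain_comp (chain_comp h g) f.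
Proof. by apply: chain_ext => i; rewrite !chain_compE. Qed.

(* The category Delta_epsilon.  A map [m] -> [epsilon] factors uniquely as
   w \o f with f : [m] -> [1], and is encoded by f; in particular w is encoded
   by the identity of [1]. *)
Inductive eobj := Chain of nat | Eps.

Definition ehom (a b : eobj) : Type :=
  match a, b with
  | Chain m, Chain n => chain_map m n
  | Chain m, Eps => chain_map m 1
  | Eps, Chain _ => Empty_set
  | Eps, Eps => unit
  end.

Definition eid (a : eobj) : ehom a a :=
  match a with Chain n => chain_id n | Eps => tt end.

Definition ecomp (a b c : eobj) : ehom b c -> ehom a b -> ehom a c :=
  match a, b, c with
  | Chain _, Chain _, Chain _ => fun g f => chain_comp g f
  | Chain _, Chain _, Eps => fun g f => chain_comp g f
  | Chain _, Eps, Eps => fun _ f => f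
  | Eps, Eps, Eps => fun _ _ => tt
  | _, Eps, Chain _ => fun g _ => match g with end
  | Eps, Chain _, _ => fun _ f => match f with end
  end.

Lemma ecomp1 a b (f : ehom a b) : ecomp f (eid a) = f.
Proof. by case: a b f => [m|] [n|] //= f; rewrite ?chain_comp1 //; case: f. Qed.

Lemma e1comp a b (f : ehom a b) : ecomp (eid b) f = f.
Proof. by case: a b f => [m|] [n|] //= f; rewrite ?chain_1comp //; case: f. Qed.

Lemma ecompA a b c d (h : ehom c d) (g : ehom b c) (f : ehom a b) :
  ecomp h (ecomp g f) = ecomp (ecomp h g) f.
Proof.
by case: a b c d h g f => [m|] [n|] [p|] [q|] //= h g f; apply: chain_compA.
Qed.

Record esset := Esset {
  cells :> eobj -> Type;
  act : forall a b : eobj, ehom a b -> cells b -> cells a;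
  act_id : forall a (x : cells a), act (eid a) x = x;
  act_comp : forall a b c (g : ehom b c) (f : ehom a b) (x : cells c),
    act (ecomp g f) x = act f (act g x)
}.

Record emap (X Y : esset) := Emap {
  emap_fun :> forall a : eobj, X a -> Y a;
  emap_natural : forall a b (f : ehom a b) (x : X b),
    emap_fun (act f x) = act f (emap_fun x)
}.

Arguments emap_fun {X Y} e a _.

Record arrow := Arrow {
  adom : esset;
  acod : esset;
  amap :> emap adom acod
}.

Definition lifts (i p : arrow) : Prop :=
  forall (u : emap (adom i) (adom p)) (v : emap (acod i) (acod p)),
    (forall a x, p a (u a x) = v a (i a x)) ->
    exists h : emap (acod i) (adom p),
      (forall a x, h a (i a x) = u a x) /\ (forall a y, p a (h a y) = v a y).

Definition llp (P : arrow -> Prop) : arrow -> Prop :=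
  fun i => forall p, P p -> lifts i p.

Definition rlp (I : arrow -> Prop) : arrow -> Prop :=
  fun p => forall i, I i -> lifts i p.

Definition generated (I : arrow -> Prop) : arrow -> Prop := llp (rlp I).

Record subesset (X : esset) := Subesset {
  smem : forall a : eobj, pred (X a);
  smem_act : forall a b (f : ehom a b) (x : X b), smem x -> smem (act f x)
}.

Arguments smem {X} s a _.

Section SubObject.
Variables (X : esset) (A : subesset X).

Definition sub_cells (a : eobj) : Type := {x : X a | smem A a x}.

Definition sub_act (a b : eobj) (f : ehom a b) (x : sub_cells b) : sub_cells a :=
  exist _ (act f (val x)) (smem_act f (valP x)).

Lemma sub_act_id a (x : sub_cells a) : sub_act (eid a) x = x.
Proof. by apply: val_inj; rewrite /= act_id. Qed.

Lemma sub_act_comp a b c (g : ehom b c) (f : ehom a b) (x : sub_cells c) :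
  sub_act (ecomp g f) x = sub_act f (sub_act g x).
Proof. by apply: val_inj; rewrite /= act_comp. Qed.

Definition sub_esset : esset := Esset sub_act_id sub_act_comp.

Definition sub_incl : emap sub_esset X :=
  @Emap sub_esset X (fun a x => val x) (fun a b f x => erefl).

Definition inclusion : arrow := Arrow sub_incl.

End SubObject.

Lemma sub_bigcup_act (X : esset) (I : finType) (P : pred I)
    (A : I -> subesset X) a b (f : ehom a b) (x : X b) :
  [exists i, P i && smem (A i) b x] ->
  [exists i, P i && smem (A i) a (act f x)].
Proof.
by move=> /existsP[i /andP[Pi xA]]; apply/existsP; exists i; rewrite Pi smem_act.
Qed.

Definition sub_bigcup X (I : finType) (P : pred I) (A : I -> subesset X) :
    subesset X :=
  Subesset (@sub_bigcup_act X I P A).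

Lemma sub_union_act (X : esset) (A B : subesset X) a b (f : ehom a b) (x : X b) :
  smem A b x || smem B b x -> smem A a (act f x) || smem B a (act f x).
Proof. by case/orP => xP; apply/orP; [left | right]; apply: smem_act. Qed.

Definition sub_union X (A B : subesset X) : subesset X :=
  Subesset (sub_union_act (A := A) (B := B)).

Section Simplex.
Variable n : nat.

Lemma long_edge_mono :
  {homo (fun i : 'I_2 => if i == ord0 then ord0 else ord_max : 'I_n.+1)
    : i j / i <= j}.
Proof.
move=> i j; case: (eqVneq i ord0) => [//|i0].
case: (eqVneq j ord0) => [->|//]; rewrite leqn0 => i0'.
by rewrite -(inj_eq val_inj) /= i0' in i0.
Qed.

Definition long_edge : chain_map 1 n := mk_chain long_edge_mono.

Definition simplex_cells (a : eobj) : Type :=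
  match a with Chain m => chain_map m n | Eps => unit end.

Definition simplex_act (a b : eobj) :
    ehom a b -> simplex_cells b -> simplex_cells a :=
  match a, b with
  | Chain _, Chain _ => fun f x => chain_comp x f
  | Chain _, Eps => fun f _ => chain_comp long_edge f
  | Eps, Chain _ => fun f _ => match f with end
  | Eps, Eps => fun _ x => x
  end.

Lemma simplex_act_id a (x : simplex_cells a) : simplex_act (eid a) x = x.
Proof. by case: a x => //= m x; rewrite chain_comp1. Qed.

Lemma simplex_act_comp a b c (g : ehom b c) (f : ehom a b)
    (x : simplex_cells c) :
  simplex_act (ecomp g f) x = simplex_act f (simplex_act g x).
Proof.
by case: a b c g f x => [m|] [p|] [q|] //= g f x; rewrite chain_compA.
Qed.

(* Delta_epsilon^n: the only cell over [epsilon] marks the edge from 0 to n. *)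
Definition esimplex : esset :=
  @Esset simplex_cells simplex_act simplex_act_id simplex_act_comp.

Implicit Type S : {set 'I_n.+1}.

Definition face_mem S (a : eobj) : pred (esimplex a) :=
  match a with
  | Chain m => fun x : chain_map m n => [forall i, x i \in S]
  | Eps => fun=> false
  end.

Lemma face_mem_act S a b (f : ehom a b) (x : esimplex b) :
  face_mem S x -> face_mem S (act f x).
Proof.
case: a b f x => [m|] [p|] //= f x /forallP xS.
by apply/forallP => i; rewrite chain_compE.
Qed.

(* Delta^S, with no marked edge *)
Definition face S : subesset esimplex := Subesset (@face_mem_act S).

Definition eface_mem S (a : eobj) : pred (esimplex a) :=
  match a with
  | Chain m => fun x : chain_map m n => [forall i, x i \in S]
  | Eps => fun=> (ord0 \in S) && (ord_max \in S)
  end.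

Lemma eface_mem_act S a b (f : ehom a b) (x : esimplex b) :
  eface_mem S x -> eface_mem S (act f x).
Proof.
case: a b f x => [m|] [p|] //= f x.
  by move=> /forallP xS; apply/forallP => i; rewrite chain_compE.
move=> /andP[S0 Sn]; apply/forallP => i; rewrite ffunE /= ffunE.
by case: ifP.
Qed.

(* The face spanned by S, in which the edge from 0 to n is marked whenever it
   belongs to the face: this is Delta_epsilon^S if 0 and n are in S. *)
Definition eface S : subesset esimplex := Subesset (@eface_mem_act S).

Definition boundary_face (i : 'I_n.+1) : subesset esimplex := eface [set~ i].

Definition horn (i : 'I_n.+1) : subesset esimplex :=
  sub_bigcup [pred j | j != i] boundary_face.

End Simplex.

Definition verts (n : nat) (s : seq nat) : {set 'I_n.+1} :=
  [set i : 'I_n.+1 | (i : nat) \in s].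

Definition eHorn : arrow -> Prop :=
  fun i => exists n, 0 < n /\
    (i = inclusion (horn (ord0 : 'I_n.+1)) \/
     i = inclusion (horn (ord_max : 'I_n.+1))).

Definition J1 : arrow -> Prop :=
  fun i => eHorn i \/
    i = inclusion (sub_union (eface (verts 4 [:: 0; 1; 2; 4]))
                             (face (verts 4 [:: 0; 2; 3]))).

Definition J2 : arrow -> Prop :=
  fun i => eHorn i \/
    i = inclusion (sub_union (eface (verts 4 [:: 0; 2; 3; 4]))
                             (face (verts 4 [:: 1; 2; 4]))).

Definition J3 : arrow -> Prop :=
  fun i => eHorn i \/
    i = inclusion (sub_union (eface (verts 4 [:: 0; 1; 2; 4]))
                             (eface (verts 4 [:: 0; 2; 3; 4]))).

(* Main.v *)
(* Let p have the right lifting property for the end horns, and call the two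
   simplices of the third generator S = 0124 and T = 0234.  If c is an end
   vertex and e the opposite one, any union of faces that all contain c and that
   covers F \ e extends along p to the face F: the missing simplices come in
   pairs (U, c * U) with e in U, and each pair is attached along an end horn with
   apex c.  With (c, e) = (0, 4) this extends S u (T \ 4) to S u T, so lifting
   against S u T implies lifting against S u (T \ 4).  Conversely, given a map on
   S u T, extend its restriction to S u (T \ 4) to the 4-simplex and keep only
   the face 0123 of the result: it is compatible with the given map, because
   (S u T) \ 4 lies in S u (T \ 4).  The union of 0123, S and T is a cone on 0
   containing 0123, hence extends to the 4-simplex.
   The case (c, e) = (4, 0), with S and T exchanged, gives the second generator. *)

Require Import Defs.
From mathcomp Require Import all_boot.

Set Implicit Arguments.
Unset Strict Implicit.
Unset Printing Implicit Defensive.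

(** * Subobjects, maps between them, and extension along a fixed arrow *)

Lemma sub_cell_inj X (A : subesset X) a (x y : sub_cells A a) : val x = val y -> x = y.
Proof. exact: val_inj. Qed.

Definition sub_cell X (A : subesset X) a x (xA : smem A a x) : sub_cells A a :=
  exist _ x xA.

Definition emap_comp X Y Z (g : emap Y Z) (f : emap X Y) : emap X Z.
Proof.
by exists (fun a x => g a (f a x)) => a b k x; rewrite !emap_natural.
Defined.

Definition sub_map X Y (A : subesset X) (B : subesset Y) (f : emap X Y)
    (fAB : forall a x, smem A a x -> smem B a (f a x)) :
  emap (sub_esset A) (sub_esset B).
Proof.
exists (fun a (x : sub_cells A a) => sub_cell (fAB a (val x) (valP x))) => a b k x.
by apply: sub_cell_inj; rewrite /= emap_natural.
Defined.

Definition sub_corestr X Y (B : subesset Y) (f : emap X Y)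
    (fB : forall a x, smem B a (f a x)) : emap X (sub_esset B).
Proof.
exists (fun a x => sub_cell (fB a x)) => a b k x.
by apply: sub_cell_inj; rewrite /= emap_natural.
Defined.

Definition emap_id X : emap X X := @Emap X X (fun a x => x) (fun a b f x => erefl).

Definition sub_preim X Y (f : emap X Y) (B : subesset Y) : subesset X.
Proof.
exists (fun a => [pred x | smem B a (f a x)]) => a b k x /= xB.
by rewrite emap_natural smem_act.
Defined.

(** Relative form of lifting: the base map lives on all of [Z], but only the cells of [B] are
    lifted. Agreement with [u] is asked on common cells, without [A] lying in [B], so that an
    extension may also be cut down to a smaller target. *)
Definition extends (p : arrow) (Z : esset) (A B : subesset Z) : Prop :=
  forall (u : emap (sub_esset A) (adom p)) (v : emap Z (acod p)),
    (forall a (x : sub_cells A a), p a (u a x) = v a (val x)) ->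
    exists h : emap (sub_esset B) (adom p),
      (forall a (x : sub_cells A a) (y : sub_cells B a),
         val x = val y -> h a y = u a x) /\
      (forall a (y : sub_cells B a), p a (h a y) = v a (val y)).

Section Extends.
Variable p : arrow.

Lemma lifts_extends (Z : esset) (A B : subesset Z) :
  lifts (inclusion A) p -> extends p A B.
Proof.
move=> Ap u v uv; have [h [hu hv]] := Ap u v uv.
exists (emap_comp h (sub_incl B)); split=> [a x y /= <-|a y]; [exact: hu | exact: hv].
Qed.

Lemma extends_lifts (Z : esset) (A B : subesset Z) :
  (forall a z, smem B a z) -> extends p A B -> lifts (inclusion A) p.
Proof.
move=> Bfull AB u v uv; have [h [hu hv]] := AB u v uv.
exists (emap_comp h (sub_corestr (f := emap_id Z) Bfull)).
by split=> [a x|a y]; [apply: hu | apply: hv].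
Qed.

Lemma extends_sub (Z : esset) (A B : subesset Z) :
  (forall a z, smem B a z -> smem A a z) -> extends p A B.
Proof.
move=> BA u v uv; exists (emap_comp u (sub_map (f := emap_id Z) BA)).
split=> [a x y xy /=|a y]; last exact: uv.
by congr (u a _); apply: sub_cell_inj.
Qed.

Lemma extends_trans (Z : esset) (A B C : subesset Z) :
  (forall a z, smem A a z -> smem B a z) ->
  extends p A B -> extends p B C -> extends p A C.
Proof.
move=> AB eAB eBC u v uv; have [h [hu hv]] := eAB u v uv.
have [k [kh kv]] := eBC h v hv; exists k; split=> // a x y xy.
have xB := AB a _ (valP x).
by rewrite (kh a (sub_cell xB) y xy) (hu a x).
Qed.

Lemma extends_lifts_trans (Z : esset) (A B : subesset Z) :
  (forall a z, smem A a z -> smem B a z) ->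
  extends p A B -> lifts (inclusion B) p -> lifts (inclusion A) p.
Proof.
move=> AB eAB Bp.
pose T : subesset Z := Subesset (smem := fun a => predT) (fun _ _ _ _ _ => isT).
by apply: (@extends_lifts _ _ T) => //; apply: (extends_trans AB eAB); apply: lifts_extends.
Qed.

(** A union is the pushout of its parts over their intersection. Membership is boolean, so the glued
    map is defined by cases on membership in [A]. *)
Lemma glue (Z X : esset) (A B : subesset Z)
    (u : emap (sub_esset A) X) (w : emap (sub_esset B) X) :
  (forall a (x : sub_cells A a) (y : sub_cells B a), val x = val y -> u a x = w a y) ->
  exists h : emap (sub_esset (sub_union A B)) X,
    (forall a (x : sub_cells A a) (z : sub_cells (sub_union A B) a),
       val x = val z -> h a z = u a x) /\
    (forall a (y : sub_cells B a) (z : sub_cells (sub_union A B) a),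
       val y = val z -> h a z = w a y).
Proof.
move=> uw.
have inB a (z : Z a) : smem A a z || smem B a z -> smem A a z = false -> smem B a z.
  by move=> + Az; rewrite Az.
pose h a (z : sub_cells (sub_union A B) a) :=
  match boolP (smem A a (val z)) with
  | AltTrue zA => u a (sub_cell zA)
  | AltFalse zA => w a (sub_cell (inB a _ (valP z) (negbTE zA)))
  end.
have hu a (x : sub_cells A a) (z : sub_cells (sub_union A B) a) :
    val x = val z -> h a z = u a x.
  move=> xz; rewrite /h; case: {-}_ / boolP => zA.
    by congr (u a _); apply: sub_cell_inj.
  by case/negP: (zA); rewrite -xz; apply: valP.
have hw a (y : sub_cells B a) (z : sub_cells (sub_union A B) a) :
    val y = val z -> h a z = w a y.
  move=> yz; rewrite /h; case: {-}_ / boolP => zA; first by apply: uw.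
  by congr (w a _); apply: sub_cell_inj.
have hn a b (k : ehom a b) z : h a (sub_act k z) = act k (h b z).
  case/orP: (valP z) => zM.
    by rewrite (hu b (sub_cell zM)) // -emap_natural; apply: hu.
  by rewrite (hw b (sub_cell zM)) // -emap_natural; apply: hw.
by exists (@Emap (sub_esset (sub_union A B)) X h hn).
Qed.

Lemma eq_lifts (Z : esset) (A B : subesset Z) :
  (forall a z, smem A a z = smem B a z) ->
  lifts (inclusion A) p <-> lifts (inclusion B) p.
Proof.
move=> AB; split; apply: extends_lifts_trans => [a z|]; rewrite ?AB //.
  by apply: extends_sub => a z; rewrite AB.
by apply: extends_sub => a z; rewrite AB.
Qed.

(** Lift [u] composed with [f] from the preimage of [A] to [W], restrict along the partial section
    [r], and glue with [u]. They agree on common cells because [r] sends those into the preimage. *)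
Lemma extends_pushout (W Z : esset) (f : emap W Z) (A B : subesset Z)
    (r : emap (sub_esset B) W) :
  (forall a (x : sub_cells B a), f a (r a x) = val x) ->
  lifts (inclusion (sub_preim f A)) p -> extends p A (sub_union A B).
Proof.
move=> fr fAp u v uv.
have fA a x : smem (sub_preim f A) a x -> smem A a (f a x) by [].
have [|h [hu hv]] := fAp (emap_comp u (sub_map fA)) (emap_comp v f).
  by move=> a x; apply: uv.
have [|g [gu gw]] := @glue _ _ A B u (emap_comp h r).
  move=> a x y xy /=.
  have ry : smem (sub_preim f A) a (r a y) by rewrite /= fr -xy; apply: valP.
  rewrite (hu a (sub_cell ry)) /=.
  by congr (u a _); apply: sub_cell_inj; rewrite /= fr.
exists g; split=> // a y; case/orP: (valP y) => yM.
  by rewrite (gu a (sub_cell yM)) // uv.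
by rewrite (gw a (sub_cell yM)) //= hv /= fr.
Qed.

(** Lift the restriction of [u] to [A], keep only the values on [P], glue them with [u] on [C], and
    lift again. Gluing is possible because [P] meets [C] inside [A]. *)
Lemma lifts_enlarge (Z : esset) (A C P : subesset Z) :
  (forall a z, smem A a z -> smem C a z) ->
  (forall a z, smem P a z -> smem C a z -> smem A a z) ->
  lifts (inclusion (sub_union P C)) p ->
  lifts (inclusion A) p -> lifts (inclusion C) p.
Proof.
move=> AC PCA PCp Ap u v uv.
have [|h [hu hv]] := Ap (emap_comp u (sub_map (f := emap_id Z) AC)) v.
  by move=> a x; apply: uv.
have [|g [gh gu]] := @glue _ _ P C (emap_comp h (sub_incl P)) u.
  move=> a x y xy /=.
  have yA : smem A a (val y) by apply: PCA (valP y); rewrite -xy; apply: valP.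
  rewrite xy (hu a (sub_cell yA)) /=.
  by congr (u a _); apply: sub_cell_inj.
have [|k [kg kv]] := PCp g v.
  move=> a x /=; case/orP: (valP x) => xM.
    by rewrite (gh a (sub_cell xM)) // [LHS]hv.
  by rewrite (gu a (sub_cell xM)) // [LHS]uv.
exists k; split=> // a x.
have xPC : smem (sub_union P C) a (val x) by apply/orP; right; apply: valP.
by rewrite [LHS](kg a (sub_cell xPC)) (gu a x).
Qed.

End Extends.

(** * Faces of the marked simplex *)

Lemma efaceS n (S T : {set 'I_n.+1}) a (x : esimplex n a) :
  S \subset T -> smem (eface S) a x -> smem (eface T) a x.
Proof.
move=> /subsetP ST; case: a x => [m|] /= x.
  by move=> /forallP xS; apply/forallP => i; apply/ST/xS.
by case/andP=> /ST -> /ST ->.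
Qed.

Lemma efaceI n (S T : {set 'I_n.+1}) a (x : esimplex n a) :
  smem (eface S) a x -> smem (eface T) a x -> smem (eface (S :&: T)) a x.
Proof.
case: a x => [m|] /= x; last by rewrite !inE => /andP[-> ->].
by move=> /forallP xS /forallP xT; apply/forallP => i; rewrite inE xS xT.
Qed.

Lemma face_eface n (S : {set 'I_n.+1}) a (x : esimplex n a) :
  ~~ ((ord0 \in S) && (ord_max \in S)) -> smem (face S) a x = smem (eface S) a x.
Proof. by case: a x => [m|] //= x /negbTE ->. Qed.

Lemma long_edge_comp m n (d : chain_map m n) :
  d ord0 = ord0 -> d ord_max = ord_max ->
  chain_comp d (long_edge m) = long_edge n.
Proof.
by move=> d0 d1; apply: chain_ext => i; rewrite chain_compE !mk_chainE; case: ifP.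
Qed.

(** Preserving both ends lets the marked cell go to the marked cell, by [long_edge_comp]. *)
Definition simplex_map m n (d : chain_map m n)
    (d0 : d ord0 = ord0) (d1 : d ord_max = ord_max) :
  emap (esimplex m) (esimplex n).
Proof.
exists (fun a => match a return esimplex m a -> esimplex n a with
                 | Chain k => fun x => chain_comp d x | Eps => id end).
case=> [k|] [l|] //= f x; first by rewrite chain_compA.
by rewrite chain_compA long_edge_comp.
Defined.

Lemma eface_simplex_map m n (d : chain_map m n) d0 d1 (S : {set 'I_n.+1}) a x :
  smem (eface S) a (@simplex_map m n d d0 d1 a x) = smem (eface (d @^-1: S)) a x.
Proof.
case: a x => [k|] /= x; last by rewrite !inE d0 d1.
by apply: eq_forallb => i; rewrite chain_compE inE.
Qed.

Lemma simplex_mapK m n (d : chain_map m n) (e : chain_map n m) d0 d1 e0 e1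
    (S : {set 'I_n.+1}) a x :
  {in S, cancel e d} -> smem (eface S) a x ->
  @simplex_map m n d d0 d1 a (@simplex_map n m e e0 e1 a x) = x.
Proof.
case: a x => [k|] //= x ed /forallP xS.
by apply: chain_ext => i; rewrite !chain_compE ed.
Qed.

(** Identifies the marked face on [S] with a standard marked simplex, as a retract: [d] enumerates
    [S] in increasing order, and [e] sends any vertex to the number of elements of [S] below it. *)
Lemma face_retraction n (S : {set 'I_n.+1}) :
  ord0 \in S -> ord_max \in S ->
  exists (d : chain_map #|S|.-1 n) (e : chain_map n #|S|.-1),
    [/\ cancel d e, {in S, cancel e d}, forall k, d k \in S,
        d ord0 = ord0 /\ d ord_max = ord_max
      & e ord0 = ord0 /\ e ord_max = ord_max].
Proof.
move=> S0 Sn.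
pose below (i : 'I_n.+1) := [set j in S | j < i].
have S_gt0 : 0 < #|S| by apply/card_gt0P; exists ord0.
have belowS i : #|below i| < #|S|.-1.+1.
  rewrite prednK //; apply: proper_card; apply/properP; split.
    by apply/subsetP => j; rewrite inE => /andP[].
  by exists ord_max => //; rewrite inE Sn /= -leqNgt -ltnS.
pose rk i := Ordinal (belowS i).
have rk_mono : {homo rk : i j / i <= j}.
  move=> i j ij; apply: subset_leq_card; apply/subsetP => k.
  by rewrite !inE => /andP[-> /= ki]; apply: leq_trans ij.
have rk_lt (i j : 'I_n.+1) : i \in S -> i < j -> rk i < rk j.
  move=> iS ij; apply: proper_card; apply/properP; split.
    by apply/subsetP => k; rewrite !inE => /andP[-> /= ki]; apply: ltn_trans ij.
  by exists i; rewrite !inE ?iS ?ltnn.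
have rk_inj : {in S &, injective rk}.
  move=> i j iS jS /(congr1 val) /= rij; apply: val_inj.
  by case: (ltngtP i j) => // [/(rk_lt _ _ iS)|/(rk_lt _ _ jS)]; rewrite /= rij ltnn.
(* [rk] is injective on [S] and its target has exactly [#|S|] vertices, so it maps [S] onto the
   target. *)
have rkS k : exists i, (i \in S) && (rk i == k).
  have /eqP rkT : rk @: S == setT.
    by rewrite eqEcard subsetT /= card_in_imset // cardsT card_ord prednK.
  have : k \in rk @: S by rewrite rkT inE.
  by case/imsetP => i iS ->; exists i; rewrite iS eqxx.
pose d k := xchoose (rkS k).
have dS k : d k \in S by case/andP: (xchooseP (rkS k)).
have dK : cancel d rk by move=> k; case/andP: (xchooseP (rkS k)) => _ /eqP.
have rkK : {in S, cancel rk d} by move=> i iS; apply: rk_inj.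
have d_mono : {homo d : k l / k <= l}.
  move=> k l kl; rewrite leqNgt; apply/negP => /(rk_lt _ _ (dS l)).
  by rewrite !dK ltnNge kl.
have rk0 : rk ord0 = ord0.
  apply: val_inj; apply/eqP; rewrite /= cards_eq0 -subset0.
  by apply/subsetP => j; rewrite !inE ltn0 andbF.
have rkn : rk ord_max = ord_max.
  have below_max : below ord_max = S :\ ord_max.
    apply/setP => j; rewrite !inE andbC; congr (_ && _).
    by rewrite -val_eqE /= ltn_neqAle -ltnS ltn_ord andbT.
  by apply: val_inj; rewrite /= below_max [in RHS](cardsD1 ord_max) Sn.
exists (mk_chain d_mono), (mk_chain rk_mono).
split=> [k|i iS|k||]; rewrite !mk_chainE //; first exact: rkK.
by rewrite -rk0 -rkn !rkK.
Qed.

(** * Cones and attachment along end horns *)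

Section Cone.
Variables (p : arrow) (n : nat).
Hypothesis p_horn : forall i, eHorn i -> lifts i p.

Definition complex (K : {set {set 'I_n.+1}}) : subesset (esimplex n) :=
  sub_bigcup (mem K) (@eface n).

Lemma complexP (K : {set {set 'I_n.+1}}) a (x : esimplex n a) :
  reflect (exists2 S, S \in K & smem (eface S) a x) (smem (complex K) a x).
Proof. exact: (iffP exists_inP). Qed.

Lemma complexU1 K S a (x : esimplex n a) :
  smem (complex (S |: K)) a x = smem (complex K) a x || smem (eface S) a x.
Proof.
apply/complexP/orP => [[T /setU1P[->|TK] xT]|[/complexP[T TK xT]|xS]].
- by right.
- by left; apply/complexP; exists T.
- by exists T => //; apply/setU1P; right.
- by exists S => //; apply: setU11.
Qed.

Lemma complex1 S a (x : esimplex n a) :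
  smem (complex [set S]) a x = smem (eface S) a x.
Proof.
apply/complexP/idP => [[T /set1P->] //|xS].
by exists S => //; apply: set11.
Qed.

(** Says that [T] is a simplex of the abstract simplicial complex spanned by [K]. *)
Definition covered (K : {set {set 'I_n.+1}}) (T : {set 'I_n.+1}) : bool :=
  [exists S in K, T \subset S].

(** [T] is a minimal missing simplex, so the face on [c |: T] meets [complex K] exactly in its horn
    at [c]. This face has both ends, as [e] is in [T]; attaching it is thus a pushout of an end
    horn. *)
Lemma extends_cone_horn (K : {set {set 'I_n.+1}}) (T : {set 'I_n.+1}) c e :
  (c, e) \in [:: (ord0, ord_max); (ord_max, ord0)] ->
  {in K, forall S : {set 'I_n.+1}, c \in S} -> c \notin T -> e \in T ->
  ~~ covered K T -> (forall t, t \in T -> covered K (T :\ t)) ->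
  extends p (complex K) (complex ((c |: T) |: K)).
Proof.
move=> ce Kc cT eT KT KTt; pose S := c |: T.
have [S0 Sn] : ord0 \in S /\ ord_max \in S.
  by move: ce eT; rewrite !inE !xpair_eqE => /orP[] /andP[/eqP-> /eqP->] ->; rewrite eqxx orbT.
have [d [r [dK rK dS [d0 dn] [r0 rn]]]] := face_retraction S0 Sn.
have S_gt1 : 0 < #|S|.-1.
  by rewrite -ltnS prednK cardsU1 cT add1n // ltnS; apply/card_gt0P; exists e.
pose f := simplex_map d0 dn.
pose g := emap_comp (simplex_map r0 rn) (sub_incl (eface S)).
have fg a (x : sub_cells (eface S) a) : f a (g a x) = val x by apply: simplex_mapK rK (valP x).
have cr : d (r c) = c by rewrite rK ?setU11.
(* Each [U] in [K] misses some [t] of [T], so its trace lies in the facet opposite [t]. Conversely,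
   a member covering [T :\ t] also contains [c] and covers that facet. *)
have horn_mem a x : smem (sub_preim f (complex K)) a x = smem (horn (r c)) a x.
  apply/complexP/exists_inP => [[U UK]|[j jc xj]].
    rewrite eface_simplex_map => xU.
    have /subsetPn[t tT tU] : ~~ (T \subset U).
      by apply: contra KT => TU; apply/exists_inP; exists U.
    have dt : d (r t) = t by rewrite rK // inE tT orbT.
    exists (r t).
      by apply: contraNneq cT => rtc; rewrite -cr -rtc dt.
    apply: efaceS xU; apply/subsetP => k; rewrite !inE => dkU.
    by apply: contraNneq tU => kt; rewrite -dt -kt.
  have djT : d j \in T.
    have := dS j; rewrite inE => /orP[] //; rewrite inE => /eqP djc.
    by case/eqP: jc; rewrite -djc dK.
  have /exists_inP[U UK TU] := KTt _ djT.
  exists U => //; rewrite eface_simplex_map; apply: efaceS xj.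
  apply/subsetP => k; rewrite !inE => kj.
  have := dS k; rewrite inE => /orP[/set1P ->|dkT]; first exact: Kc.
  apply: (subsetP TU); rewrite !inE dkT andbT.
  by apply: contraNneq kj => /(can_inj dK) ->.
have horn_lifts : lifts (inclusion (horn (r c))) p.
  apply: p_horn; exists #|S|.-1; split=> //.
  by move: ce; rewrite !inE !xpair_eqE => /orP[] /andP[/eqP-> _];
    [left; rewrite r0 | right; rewrite rn].
have preim_lifts : lifts (inclusion (sub_preim f (complex K))) p.
  exact/(eq_lifts _ horn_mem).
apply: (extends_trans _ (extends_pushout fg preim_lifts)).
  by move=> a x /= ->.
by apply: extends_sub => a x; rewrite complexU1.
Qed.

Lemma cone_extends (K : {set {set 'I_n.+1}}) (S : {set 'I_n.+1}) c e :
  (c, e) \in [:: (ord0, ord_max); (ord_max, ord0)] ->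
  {in K, forall S : {set 'I_n.+1}, c \in S} -> c \in S -> covered K (S :\ e) ->
  extends p (complex K) (complex (S |: K)).
Proof.
move=> ce + cS.
(* Induction on the number of uncovered sets: attaching [c |: T] for a minimal uncovered [T] inside
   [S] lowers it. *)
have [N] := ubnP #|[set T : {set 'I_n.+1} | ~~ covered K T]|.
elim: N K => // N IHN K; rewrite ltnS => KN Kc KS.
have [/exists_inP[U UK SU]|nKS] := boolP (covered K S).
  apply: extends_sub => a x; rewrite complexU1 => /orP[] // xS.
  by apply/complexP; exists U => //; apply: efaceS xS.
have [T Tmin TS] := minset_exists (P := fun T => ~~ covered K T) nKS.
have [KT Tsmall] := minsetP Tmin.
have KTt t : t \in T -> covered K (T :\ t).
  move=> tT; apply: contraT => /Tsmall/(_ (subD1set _ _)) Tt.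
  by move: tT; rewrite -Tt !inE eqxx.
(* A member covering [T :\ c] contains [c], so it would cover a [T] containing [c]. Next, a [T]
   without [e] would lie in the covered set [S :\ e]. *)
have cT : c \notin T.
  apply: contra KT => /[dup] /KTt /exists_inP[U UK TU] cT.
  apply/exists_inP; exists U => //; apply/subsetP => i iT.
  by have [->|ic] := eqVneq i c; [apply: Kc | apply: (subsetP TU); rewrite !inE ic].
have eT : e \in T.
  apply: contraNT KT => eT; have /exists_inP[U UK SU] := KS.
  apply/exists_inP; exists U => //; apply: subset_trans SU.
  by rewrite subsetD1 TS.
pose K' := (c |: T) |: K.
have KK' V : covered K V -> covered K' V.
  by case/exists_inP => U UK VU; apply/exists_inP; exists U => //; apply/setU1P; right.
have K'T : covered K' T by apply/exists_inP; exists (c |: T); rewrite ?setU11 ?subsetUr.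
have eKK' : extends p (complex K) (complex K') by apply: (extends_cone_horn (e := e)).
apply: extends_trans eKK' _; first by move=> a x; rewrite complexU1 => ->.
apply: (@extends_trans _ _ _ (complex (S |: K'))).
- by move=> a x xK; rewrite complexU1 xK.
- apply: IHN; last exact: KK'.
    apply: leq_trans KN; apply: proper_card; apply/properP; split.
      by apply/subsetP => V; rewrite !inE; apply: contra; apply: KK'.
    by exists T; rewrite !inE ?K'T.
  by move=> U /setU1P[->|/Kc //]; rewrite setU11.
(* The target lies inside [complex (S |: K')], so this is a mere restriction. *)
- apply: extends_sub => a x; rewrite !complexU1.
  by case/orP => ->; rewrite ?orbT.
Qed.

(** Both directions rest on [cone_extends]: one fills the whole simplex from the face opposite [e]
    together with [S] and [T], the other completes [T :\ e] to [T]. *)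
Lemma lifts_cone_iff (S T : {set 'I_n.+1}) c e :
  0 < n ->
  (c, e) \in [:: (ord0, ord_max); (ord_max, ord0)] -> c \in S -> c \in T ->
  lifts (inclusion (sub_union (eface S) (eface (T :\ e)))) p <->
  lifts (inclusion (sub_union (eface S) (eface T))) p.
Proof.
move=> n_gt0 ce cS cT.
have c_neq_e : c != e.
  by move: ce; rewrite !inE !xpair_eqE => /orP[] /andP[/eqP-> /eqP->];
    rewrite -val_eqE /= -?lt0n ?[0 == n]eq_sym -?lt0n.
have AC a (x : esimplex n a) : smem (sub_union (eface S) (eface (T :\ e))) a x ->
    smem (sub_union (eface S) (eface T)) a x.
  by case/orP=> xM; apply/orP; [left | right]; rewrite ?(efaceS _ xM) ?subD1set.
split=> [Ap|].
  (* The face opposite [e] meets [eface T] inside [eface (T :\ e)]. *)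
  apply: (lifts_enlarge (P := boundary_face e) AC) Ap => [a x xe|].
    case/orP => xM; apply/orP; [by left | right].
    by apply: efaceS (efaceI xM xe); rewrite setDE.
  have PC_complex a (x : esimplex n a) :
      smem (sub_union (boundary_face e) (sub_union (eface S) (eface T))) a x =
      smem (complex (~: [set e] |: (S |: [set T]))) a x.
    by rewrite !complexU1 complex1 orbC [X in _ || X]orbC.
  apply/(eq_lifts _ PC_complex).
  apply: extends_lifts (cone_extends ce (S := setT) _ _ _).
  - move=> a x; rewrite complexU1; apply/orP; right.
    by case: a x => [m|] x /=; [apply/forallP => i|]; rewrite !inE.
  - by move=> U; rewrite !inE => /or3P[] /eqP-> //; rewrite !inE.
  - by rewrite inE.
  - by apply/exists_inP; exists (~: [set e]); rewrite ?setU11 // setTD.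
apply: extends_lifts_trans AC _.
have A_complex a (x : esimplex n a) :
    smem (sub_union (eface S) (eface (T :\ e))) a x =
    smem (complex (S |: [set T :\ e])) a x by rewrite complexU1 complex1 orbC.
apply: (@extends_trans _ _ _ (complex (S |: [set T :\ e]))).
- by move=> a x; rewrite A_complex.
- by apply: extends_sub => a x; rewrite A_complex.
apply: (@extends_trans _ _ _ (complex (T |: (S |: [set T :\ e])))).
- by move=> a x xM; rewrite complexU1 xM.
- apply: (cone_extends ce) => //.
    by move=> U; rewrite !inE => /orP[] /eqP-> //; rewrite !inE c_neq_e.
  by apply/exists_inP; exists (T :\ e); rewrite // !inE eqxx orbT.
by apply: extends_sub => a x; rewrite !complexU1 complex1 /= => /orP[->|->]; rewrite ?orbT.
Qed.

(** [T :\ e] lacks an end vertex, so [face] and [eface] agree on it; this matches the shape of the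
    first two generators. *)
Lemma lifts_cone_face_iff (S T U : {set 'I_n.+1}) c e :
  0 < n ->
  (c, e) \in [:: (ord0, ord_max); (ord_max, ord0)] -> c \in S -> c \in T ->
  T :\ e = U ->
  lifts (inclusion (sub_union (eface S) (face U))) p <->
  lifts (inclusion (sub_union (eface S) (eface T))) p.
Proof.
move=> n_gt0 ce cS cT <-; apply: iff_trans (lifts_cone_iff n_gt0 ce cS cT).
apply: eq_lifts => a x; congr (_ || _); apply: face_eface.
by move: ce; rewrite !inE !xpair_eqE => /orP[] /andP[_ /eqP->]; rewrite eqxx ?andbF.
Qed.

End Cone.

(** * Comparison of the generated classes *)

(** Comparing [i] with [j] is required only for [p] that already lifts against the common part [I];
    here that part supplies the end horns. *)
Lemma eq_rlp_adjoin (I : arrow -> Prop) (i j p : arrow) :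
  (rlp I p -> (lifts i p <-> lifts j p)) ->
  rlp (fun f => I f \/ f = i) p <-> rlp (fun f => I f \/ f = j) p.
Proof.
move=> ij; split=> Ip.
  have p_rlp : rlp I p by move=> f If; apply: Ip; left.
  by move=> f [/p_rlp //|->]; apply/(ij p_rlp)/Ip; right.
have p_rlp : rlp I p by move=> f If; apply: Ip; left.
by move=> f [/p_rlp //|->]; apply/(ij p_rlp)/Ip; right.
Qed.

Lemma eq_generated (I J : arrow -> Prop) :
  (forall p, rlp I p <-> rlp J p) -> forall f, generated I f <-> generated J f.
Proof. by move=> IJ f; split=> If p /IJ; apply: If. Qed.

Lemma rlp_J1_J3 p : rlp J1 p <-> rlp J3 p.
Proof.
apply: eq_rlp_adjoin => p_horn.
apply: (lifts_cone_face_iff p_horn (c := ord0) (e := ord_max)); rewrite ?inE ?eqxx //.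
by apply/setP => -[[|[|[|[|[|]]]]] ?]; rewrite // !inE.
Qed.

Lemma rlp_J2_J3 p : rlp J2 p <-> rlp J3 p.
Proof.
apply: eq_rlp_adjoin => p_horn.
(* The union is written in the opposite order to [J3], so that 0124 is the face losing the vertex 0,
   which leaves 124. *)
apply: (iff_trans (B := lifts (inclusion (sub_union
    (eface (verts 4 [:: 0; 2; 3; 4])) (eface (verts 4 [:: 0; 1; 2; 4])))) p)).
  apply: (lifts_cone_face_iff p_horn (c := ord_max) (e := ord0)); rewrite ?inE ?eqxx //.
  by apply/setP => -[[|[|[|[|[|]]]]] ?]; rewrite // !inE.
by apply: eq_lifts => a x; apply: orbC.
Qed.

Theorem theorem6p7 :
  (forall f : arrow, generated J1 f <-> generated J2 f) /\
  (forall f : arrow, generated J2 f <-> generated J3 f).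
Proof.
split; apply: eq_generated => p; last exact: rlp_J2_J3.
exact: iff_trans (rlp_J1_J3 p) (iff_sym (rlp_J2_J3 p)).
Qed.
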